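(* For any prime $p$, $$(\partial f)^{p-1}\equiv-\,\partial^{p-1}f^{p-1}\pmod p,$$ where both sides are words in the two letters $\partial,f$, regarded as integral linear combinations of differential monomials $f^{(k_1)}\cdots f^{(k_m)}$. That is, in the differential polynomial ring $\mathbb{Z}[f,f',f'',\dots]$ the difference of the two sides has all coefficients divisible by $p$.
   Context: Let $\mathbb{Z}[f,f',f'',\dots]=\mathbb{Z}[f^{(0)},f^{(1)},f^{(2)},\dots]$ be the polynomial ring in the independent variables $f^{(k)}$, $k\ge 0$ ($f=f^{(0)}$), with the derivation $\partial$ determined by $\partial f^{(k)}=f^{(k+1)}$. A finite word in the letters $\partial,f$ ending with $f$ is interpreted as an element of this ring by reading from right to left: each letter $f$ multiplies everything to its right by $f$, and each letter $\partial$ differentiates everything to its right. For example, $\partial f\partial\partial f=(f f'')'=f'f''+ff'''$. Thus $(\partial f)^{p-1}$ denotes the word $\partial f\,\partial f\cdots\partial f$ with $p-1$ letters $\partial$ and $p-1$ letters $f$, i.e. $\partial(f\,\partial(f\cdots\partial(f\,\partial f)\cdots))$ (not the $(p-1)$-st power of $f'$), and $\partial^{p-1}f^{p-1}$ denotes the $(p-1)$-st derivative of the power $f^{p-1}$. *)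

(* Defs.v *)
From HB Require Import structures.
From mathcomp Require Import all_boot all_order all_algebra.
From mathcomp Require Import finmap.
From mathcomp Require Export monalg.

Set Implicit Arguments.
Unset Strict Implicit.
Unset Printing Implicit Defensive.

Import GRing.Theory.
Local Open Scope ring_scope.

(* Z[f, f', f'', ...]: integral polynomials in countably many independent     *)
(* variables. A monomial m stands for \prod_k (f^(k)) ^ (m k).                *)
Notation dpoly := {malg int[{cmonom nat}]}.

(* The variable f^(k), the k-th formal derivative of f = dvar 0.              *)
Definition dvar (k : nat) : dpoly := << ucm k >>.

(* The derivation is fixed on monomials by Leibniz' rule:                     *)
(*   \sum_k (m k) * (m / f^(k)) * f^(k+1),                                    *)
(* and then extended Z-linearly; dderM, dderX and dder_uniq below check that  *)
(* it is the unique derivation sending each f^(k) to f^(k+1).                 *)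
Definition dder_mon (m : {cmonom nat}) : dpoly :=
  \sum_(k <- finsupp m) (<< divcm m (ucm k) >> * dvar k.+1) *+ m k.

Definition dder (P : dpoly) : dpoly := mmap malgC dder_mon P.

HB.instance Definition _ := GRing.Additive.copy dder (mmap malgC dder_mon).

Inductive letter := Ld | Lf.

Notation word := (seq letter).

Definition wexp (w : word) (n : nat) : word := flatten (nseq n w).

Definition letter_act (l : letter) (P : dpoly) : dpoly :=
  match l with Ld => dder P | Lf => dvar 0 * P end.

(* Right-to-left reading; starting from 1 makes a final letter f mean f.      *)
Definition weval (w : word) : dpoly := foldr letter_act 1 w.

Definition dpoly_congr (n : nat) (P Q : dpoly) : Prop :=
  forall m : {cmonom nat}, (n %| (P - Q)@_m)%Z.

Lemma dder_monU (c : int) (m : {cmonom nat}) : dder << c *g m >> = c%:MP * dder_mon m.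
Proof. exact: mmapU. Qed.

Lemma dder_monEw (d : {fset nat}) (m : {cmonom nat}) : (finsupp m `<=` d)%fset ->
  dder_mon m = \sum_(k <- d) (<< divcm m (ucm k) >> * dvar k.+1) *+ m k.
Proof.
move=> le; rewrite /dder_mon (big_fset_incl _ le) // => k _.
by rewrite -cmE_neq0 negbK => /eqP ->.
Qed.

Lemma malgU_mul (c1 c2 : int) (m1 m2 : {cmonom nat}) :
  << c1 *g m1 >> * << c2 *g m2 >> = << c1 * c2 *g mmul m1 m2 >> :> dpoly.
Proof.
by rewrite (malgMEw msuppU_le msuppU_le) !big_seq_fset1 !mcoeffUU.
Qed.

Lemma malgUE (c : int) (m : {cmonom nat}) :
  << c *g m >> = c%:MP * << m >> :> dpoly.
Proof. by rewrite malgU_mul mulr1 mul1m. Qed.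

Lemma malgU1_mul (m1 m2 : {cmonom nat}) :
  << m1 >> * << m2 >> = << mmul m1 m2 >> :> dpoly.
Proof. by rewrite (malgU_mul 1 1) mulr1. Qed.

Lemma dder_monM (m1 m2 : {cmonom nat}) :
  dder_mon (mmul m1 m2) = dder_mon m1 * << m2 >> + << m1 >> * dder_mon m2.
Proof.
have half (a b : {cmonom nat}) k :
    (<< divcm (mmul a b) (ucm k) >> * dvar k.+1) *+ a k
    = (<< divcm a (ucm k) >> * dvar k.+1) *+ a k * << b >> :> dpoly.
  have mulrnE (x y z : dpoly) n : (n != 0%N -> x = y * z) -> x *+ n = y *+ n * z.
    case: n => [_|n ->//]; last by rewrite mulrnAl.
    by rewrite (mulr0n x) (mulr0n y) mul0r.
  apply: mulrnE => ak.
  have E : divcm (mmul a b) (ucm k) = mmul (divcm a (ucm k)) b.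
    apply/eqP/cmP => i; rewrite cmM !divcmE cmM ucmE.
    case: eqP => [<-|_] /=; last by rewrite !subn0.
    by rewrite addnBAC // lt0n.
  rewrite E.
  rewrite -(malgU1_mul (divcm a (ucm k)) b).
  exact: mulrAC.
rewrite (dder_monEw (d := (finsupp m1 `|` finsupp m2)%fset)) ?mdomD //.
rewrite (dder_monEw (fsubsetUl _ (finsupp m2))).
rewrite (dder_monEw (fsubsetUr (finsupp m1) _)).
rewrite [X in X + _]mulr_suml.
rewrite [X in _ + X]mulr_sumr.
rewrite -big_split.
apply: eq_bigr => k _.
rewrite /=.
rewrite (cmM k m1 m2).
rewrite [LHS]mulrnDr.
congr (_ + _).
exact: half.
rewrite mulmC.
rewrite [RHS]mulrC.
exact: half.
Qed.

Lemma dderM_monU (c1 c2 : int) (m1 m2 : {cmonom nat}) :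
  dder (<< c1 *g m1 >> * << c2 *g m2 >>) =
  dder << c1 *g m1 >> * << c2 *g m2 >> + << c1 *g m1 >> * dder << c2 *g m2 >>.
Proof.
have aux (R : comNzRingType) (c d a b a' b' : R) :
    c * d * (a' * b + a * b') = c * a' * (d * b) + c * a * (d * b').
  by rewrite mulrDr mulrACA (mulrACA c d a b').
transitivity (c1%:MP * c2%:MP * (dder_mon m1 * << m2 >> + << m1 >> * dder_mon m2)).
  transitivity (dder << c1 * c2 *g mmul m1 m2 >>).
    by congr (dder _); apply: malgU_mul.
  rewrite dder_monU; congr (_ * _); first exact: mpolyCM.
  exact: dder_monM.
apply: etrans (aux _ _ _ _ _ _ _) _.
apply: (f_equal2 +%R); apply: (f_equal2 *%R).
- exact/esym/dder_monU.
- exact/esym/malgUE.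
- exact/esym/malgUE.
- exact/esym/dder_monU.
Qed.

Lemma dpoly_ind (K : dpoly -> Prop) :
    K 0 -> (forall P Q, K P -> K Q -> K (P + Q)) ->
    (forall c m, K << c *g m >>) ->
  forall P, K P.
Proof. by move=> K0 KD KU P; rewrite (monalgE P); apply: big_ind. Qed.

Lemma dder0 : dder 0 = 0. Proof. exact: raddf0. Qed.

Lemma dderD (P Q : dpoly) : dder (P + Q) = dder P + dder Q.
Proof. exact: raddfD. Qed.

Lemma dderM (P Q : dpoly) : dder (P * Q) = dder P * Q + P * dder Q.
Proof.
have auxl (R : comNzRingType) (p p' q a a' b : R) :
    a * q + p * b + (a' * q + p' * b) = (a + a') * q + (p + p') * b.
  by rewrite addrACA -!mulrDl.
have auxr (R : comNzRingType) (p q q' a b b' : R) :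
    a * q + p * b + (a * q' + p * b') = a * (q + q') + p * (b + b').
  by rewrite addrACA -!mulrDr.
elim/dpoly_ind: P => [|P1 P2 IH1 IH2|c1 m1].
- by rewrite (mul0r Q) dder0 (mul0r Q) (mul0r (dder Q)) addr0.
- apply: etrans (congr1 dder (mulrDl P1 P2 Q)) _.
  apply: etrans (dderD _ _) _.
  apply: etrans (f_equal2 +%R IH1 IH2) _.
  apply: etrans (auxl _ _ _ _ _ _ _) _.
  apply: (f_equal2 +%R); last exact: erefl.
  by apply: (f_equal2 *%R); [apply/esym/dderD | exact: erefl].
set P' := << c1 *g m1 >>.
elim/dpoly_ind: Q => [|Q1 Q2 IH1 IH2|c2 m2].
- by rewrite (mulr0 P') dder0 (mulr0 (dder P')) (mulr0 P') addr0.
- apply: etrans (congr1 dder (mulrDr _ Q1 Q2)) _.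
  apply: etrans (dderD _ _) _.
  apply: etrans (f_equal2 +%R IH1 IH2) _.
  apply: etrans (auxr _ _ _ _ _ _ _) _.
  apply: (f_equal2 +%R); first exact: erefl.
  by apply: (f_equal2 *%R); [exact: erefl | apply/esym/dderD].
exact: (dderM_monU c1 c2 m1 m2).
Qed.

Lemma dderX k : dder (dvar k) = dvar k.+1.
Proof.
rewrite dder_monU mpolyC1E mul1r /dder_mon mdomU big_seq_fset1 cmUU mulr1n.
suff -> : divcm (ucm k) (ucm k) = mone by rewrite mpolyC1E mul1r.
by apply/eqP/cmP => i; rewrite divcmE subnn cm1.
Qed.

Lemma dder_uniq (D : {additive dpoly -> dpoly}) :
    (forall P Q, D (P * Q) = D P * Q + P * D Q) ->
    (forall k, D (dvar k) = dvar k.+1) ->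
  D =1 dder.
Proof.
move=> DM DX.
have at1 (E : dpoly -> dpoly) :
    (forall P Q, E (P * Q) = E P * Q + P * E Q) -> E 1 = 0.
  move=> EM; have := EM 1 1; rewrite (mulr1 1) (mulr1 (E 1)) (mul1r (E 1)).
  by move/eqP; rewrite -subr_eq subrr eq_sym => /eqP.
have Dm (m : {cmonom nat}) : D << m >> = dder << m >>.
  have [n] := ubnP (mdeg m); elim: n m => // n IHn m.
  have [m0|/fset0Pn [k km]] := eqVneq (finsupp m) fset0.
    suff -> : << m >> = 1 :> dpoly by move=> _; rewrite (at1 D DM) (at1 dder dderM).
    suff -> : m = mone by [].
    by apply/eqP/cmP => i; rewrite cm1; apply/eqP; rewrite cmE_eq0 m0.
  have E : m = mmul (ucm k) (divcm m (ucm k)).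
    apply/eqP/cmP => i; rewrite cmM divcmE cmU; case: eqP => [<-|_] /=.
      by rewrite subnKC // lt0n cmE_neq0.
    by rewrite subn0.
  rewrite {1}E mdegM mdegU add1n ltnS => /IHn IH.
  have -> : << m >> = dvar k * << divcm m (ucm k) >> :> dpoly.
    apply: etrans (esym (malgU1_mul (ucm k) (divcm m (ucm k)))).
    by rewrite {1}E.
  apply: etrans (DM _ _) _; apply: esym; apply: etrans (dderM _ _) _.
  apply: (f_equal2 +%R); apply: (f_equal2 *%R).
  - exact: etrans (dderX k) (esym (DX k)).
  - exact: erefl.
  - exact: erefl.
  - exact: esym IH.
elim/dpoly_ind => [|P Q IHP IHQ|c m].
- by rewrite dder0 raddf0.
- by apply: etrans (raddfD D P Q) _; rewrite IHP IHQ; apply/esym/dderD.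
have -> : << c *g m >> = << m >> *~ c :> dpoly.
  apply/malgP => i; rewrite mcoeffU (raddfMz (mcoeff i)) /= mcoeffU.
  by case: eqP => _; rewrite ?mulr0n ?mul0rz // mulr1n intz.
by rewrite !raddfMz Dm.
Qed.

Lemma weval_dX_fX (a b : nat) :
  weval (wexp [:: Ld] a ++ wexp [:: Lf] b) = iter a dder (dvar 0 ^+ b).
Proof.
elim: a => [|a IHa] /=; last by rewrite -IHa.
by elim: b => [|b IHb] //=; rewrite exprS -IHb.
Qed.

Lemma weval_df (n : nat) :
  weval (wexp [:: Ld; Lf] n) = iter n (fun P => dder (dvar 0 * P)) 1.
Proof.
elim: n => [|n IHn]; first exact: erefl.
exact: (congr1 (fun P => dder (dvar 0 * P)) IHn).
Qed.

(* Main.v *)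
Require Import Defs.
From mathcomp Require Import all_boot all_order all_algebra.
From mathcomp Require Import finmap ring.

(** Write D for the derivation and T for the sum of the two sides,
    (D f)^(p-1) 1 + D^(p-1) (f^(p-1)); the claim is T = 0 mod p. The proof
    shows that D T = 0 mod p and that, modulo p, D is injective on polynomials
    homogeneous of the degree of T.

    Let E be the derivation x |-> f * D x. Its powers expand as
    E^n = \sum_k a_(n,k) D^k with coefficients a_(n,k) not depending on x,
    and modulo p only two terms of E^p survive (Hochschild's formula,
    [hochschild]):
      E^p = f^p D^p + E^(p-1)(f) D  mod p.
    The idea behind it is that E^p is again a derivation modulo p, whereas
    \sum_k a_k D^k can be a derivation for generic D only if every a_k with
    1 < k < p vanishes. Here this is made concrete by the identity
      k a_(n,k) = \sum_i 'C(n, i) a_(n-i,k-1) a_(i,1)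
    ([der_pow_coef_mulrn]), which would follow from Leibniz' rule for
    E^n (t * exp (t z)) if there were elements with D t = 1 and
    D (exp (t z)) = z exp (t z); for n = p all binomial coefficients but the
    outer two vanish modulo p, hence so does k a_(p,k) for 1 < k < p.

    Put g = (D f)^(p-1) 1, so that f g = E^(p-1) f. Applying Hochschild's
    formula to f itself gives f^2 D g = f^p D^p f mod p. As D^p is a
    derivation modulo p, D^p (f^(p-1)) = - f^(p-2) D^p f mod p. The two
    contributions cancel: f^2 D T = 0 mod p ([der_sum_pmult]), and f^2, being
    a monomial, can be cancelled in Z[f, f', ...].

    Finally T is homogeneous of degree p-1. Suppose that a polynomial of
    degree n with 0 < n < p is killed by D modulo p but is nonzero modulo p,
    discard its monomials with coefficient divisible by p, and let f^(k) be the
    highest derivative left. A monomial m containing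
    f^(k) to the power e > 0 then produces e times m f^(k+1) / f^(k) in the
    derivative, nothing else produces that monomial, and e <= n < p is
    invertible: contradiction ([dder_ker]). *)

Set Implicit Arguments.
Unset Strict Implicit.
Unset Printing Implicit Defensive.

Import GRing.Theory.
Local Open Scope ring_scope.

(** * Multiples of p in a commutative ring *)

Section Congruences.
Variables (R : comNzRingType) (p : nat).

(** Congruences modulo p are stated inside R rather than in R / pR, so that the
    derivation of R itself can be used throughout. *)
Definition pmult (x : R) : Prop := exists y, x = y *+ p.

Lemma pmult0 : pmult 0.
Proof. by exists 0; rewrite mul0rn. Qed.

Lemma pmultD (x y : R) : pmult x -> pmult y -> pmult (x + y).
Proof. by move=> [x' ->] [y' ->]; exists (x' + y'); rewrite mulrnDl. Qed.

Lemma pmultMl (x y : R) : pmult y -> pmult (x * y).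
Proof. by move=> [y' ->]; exists (x * y'); rewrite mulrnAr. Qed.

Lemma pmult_sum (I : Type) (r : seq I) (P : pred I) (F : I -> R) :
  (forall i, P i -> pmult (F i)) -> pmult (\sum_(i <- r | P i) F i).
Proof. by move=> FP; apply: big_ind => //; [exact: pmult0|exact: pmultD]. Qed.

Lemma pmult_coprime (x : R) (k : nat) :
  (0 < k)%N -> coprime k p -> pmult (x *+ k) -> pmult x.
Proof.
move=> k_gt0 co_kp [y xk]; have [u v uk _] := egcdnP p k_gt0.
exists (y *+ u - x *+ v).
rewrite mulrnBl -!mulrnA (mulnC u) mulrnA -xk -mulrnA (mulnC k) uk.
by rewrite (eqP co_kp) mulrnDr mulr1n addrC addKr.
Qed.

End Congruences.

(** * Binomial convolution *)

Section BinomialConvolution.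
Variable R : comNzRingType.
Implicit Types F G : nat -> R.

Definition bconv F G n := \sum_(i < n.+1) F (n - i)%N * G i *+ 'C(n, i).

(** Pascal's rule. It is the induction step both of Leibniz' rule for iterated
    derivatives and of [der_pow_coef_mulrn]. *)
Lemma bconvS F G n : bconv F G n.+1 =
  \sum_(i < n.+1) (F (n - i).+1 * G i + F (n - i)%N * G i.+1) *+ 'C(n, i).
Proof.
rewrite /bconv big_ord_recl bin0 subn0.
under eq_bigr => i _ do rewrite /= /bump leq0n add1n subSS binS mulrnDr.
rewrite big_split /= addrA.
under [RHS]eq_bigr => i _ do rewrite mulrnDl.
rewrite [RHS]big_split /=; congr (_ + _).
rewrite big_ord_recr /= bin_small // mulr0n addr0 big_ord_recl bin0 subn0.
congr (_ + _); apply: eq_bigr => i _.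
by rewrite /= /bump leq0n add1n subnSK.
Qed.

Lemma bconv_prime F G p : prime p ->
  pmult p (bconv F G p - (F p * G 0%N + F 0%N * G p)).
Proof.
move=> p_pr; have p_gt0 := prime_gt0 p_pr.
case: p p_pr p_gt0 => // n p_pr _.
rewrite /bconv big_ord_recl big_ord_recr /= /bump leq0n add1n !subn0 subnn.
rewrite bin0 binn !mulr1n opprD addrACA subrr add0r addrK.
apply: pmult_sum => i _.
have /dvdnP[q ->] : (n.+1 %| 'C(n.+1, i.+1))%N.
  by apply: prime_dvd_bin => //=; rewrite ltnS.
by exists (F (n.+1 - i.+1)%N * G i.+1 *+ q); rewrite mulrnA.
Qed.

End BinomialConvolution.

(** * Powers of f D modulo p *)

Section Derivation.
Variables (R : comNzRingType) (D : {additive R -> R}).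
Hypothesis DM : forall x y, D (x * y) = D x * y + x * D y.

Lemma iter_derM n x y :
  iter n D (x * y) = bconv (fun i => iter i D x) (fun i => iter i D y) n.
Proof.
elim: n => [|n IHn]; first by rewrite /bconv big_ord1 /=.
rewrite bconvS iterS IHn raddf_sum; apply: eq_bigr => i _.
by rewrite raddfMn /= DM.
Qed.

(** Modulo p the map D^p is a derivation, so it differentiates powers by the
    usual rule. *)
Lemma iter_der_expr p n x : prime p ->
  pmult p (iter p D (x ^+ n.+1) - x ^+ n * iter p D x *+ n.+1).
Proof.
move=> p_pr; elim: n => [|n IHn].
  by rewrite expr1 expr0 mul1r subrr; exact: pmult0.
rewrite exprS iter_derM.
have := pmultD (bconv_prime (fun i => iter i D x)
  (fun i => iter i D (x ^+ n.+1)) p_pr) (pmultMl x IHn).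
congr pmult; rewrite /= exprS [in RHS]mulrS; ring.
Qed.

Variable f : R.
Let E (x : R) := f * D x.

(** The coefficients of z * \sum_k (c k) z^k. *)
Definition shift_coef (c : nat -> R) (k : nat) : R :=
  if k is k'.+1 then c k' else 0.

(** The coefficient of D^k in E^n; the recursion is the product rule
    E (a * D^k x) = f * D a * D^k x + f * a * D^(k+1) x. *)
Fixpoint der_pow_coef (n k : nat) : R :=
  if n is n'.+1 then
    f * (D (der_pow_coef n' k) + shift_coef (der_pow_coef n') k)
  else (k == 0%N)%:R.

Local Notation a := der_pow_coef.

Lemma der_pow_coefS n k : a n.+1 k = f * (D (a n k) + shift_coef (a n) k).
Proof. by []. Qed.
Arguments der_pow_coef : simpl never.

Lemma der_pow_coef0 k : a 0 k = (k == 0%N)%:R.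
Proof. by []. Qed.

Lemma der1 : D 1 = 0.
Proof.
by have /eqP := DM 1 1; rewrite !mulr1 mul1r -subr_eq subrr eq_sym => /eqP.
Qed.

Lemma der_pow_coef_small n k : (n < k)%N -> a n k = 0.
Proof.
elim: n k => [|n IHn] [|k] //= lt_nk.
by rewrite der_pow_coefS /= !IHn ?(ltnW lt_nk) // raddf0 addr0 mulr0.
Qed.

Lemma der_pow_coef_diag n : a n n = f ^+ n.
Proof.
elim: n => // n IHn.
by rewrite der_pow_coefS der_pow_coef_small // raddf0 add0r exprS -IHn.
Qed.

Lemma der_pow_coefS_0 n : a n.+1 0 = 0.
Proof.
elim: n => [|n IHn].
  by rewrite der_pow_coefS der_pow_coef0 der1 addr0 mulr0.
by rewrite der_pow_coefS IHn raddf0 addr0 mulr0.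
Qed.

Lemma der_pow_coefS_1 n : a n.+1 1 = iter n E f.
Proof.
elim: n => [|n IHn].
  by rewrite der_pow_coefS /= !der_pow_coef0 raddf0 add0r mulr1.
by rewrite iterS -IHn der_pow_coefS /= der_pow_coefS_0 addr0.
Qed.

Lemma iter_fD_expand n x : iter n E x = \sum_(k < n.+1) a n k * iter k D x.
Proof.
elim: n => [|n IHn]; first by rewrite big_ord1 der_pow_coef0 mul1r.
rewrite iterS IHn /E raddf_sum mulr_sumr.
under eq_bigr => k _ do rewrite /= DM mulrDr.
under [RHS]eq_bigr => k _ do rewrite der_pow_coefS mulrDr mulrDl.
rewrite !big_split; congr (_ + _).
  rewrite [RHS]big_ord_recr /= der_pow_coef_small // raddf0 mulr0 mul0r addr0.
  by apply: eq_bigr => k _; rewrite mulrA.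
rewrite [RHS]big_ord_recl /= mulr0 mul0r add0r.
by apply: eq_bigr => k _; rewrite /= mulrA.
Qed.

(** With A_n(z) = \sum_k a_(n,k) z^k this is the coefficientwise form of
    z * A_n'(z) = \sum_i 'C(n, i) z * A_(n-i)(z) * a_(i,1). If D t = 1, both
    sides of A_n'(z) = ... describe the commutator of E^n with multiplication by
    t, because E^i t = a_(i,1) for i > 0. Induction on n proves the identity
    without adjoining such a t. *)
Lemma der_pow_coef_mulrn n k :
  a n k *+ k = bconv (fun i => shift_coef (a i) k) (fun i => a i 1) n.
Proof.
elim: n k => [|n IHn] k.
  rewrite /bconv big_ord1 /= !der_pow_coef0 mulr0 mul0rn.
  by case: k => //= k; rewrite mul0rn.
case: k => [|k].
  by rewrite mulr0n /bconv big1 // => i _; rewrite mul0r mul0rn.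
rewrite bconvS.
(* The extra summand a_(n,k) splits off so that the induction hypothesis at k
   applies; it is absorbed by the term i = 0 below, since a_(1,1) = f. *)
have -> : a n.+1 k.+1 *+ k.+1 =
    f * (D (a n k.+1 *+ k.+1) + a n k *+ k + a n k).
  by rewrite der_pow_coefS -mulrnAr mulrnDl raddfMn -addrA -mulrSr.
rewrite !IHn /bconv raddf_sum -big_split /= mulrDr mulr_sumr.
rewrite big_ord_recl [in RHS]big_ord_recl.
rewrite addrAC; congr (_ + _).
  rewrite /= !bin0 !subn0 !mulr1n der_pow_coef0 der_pow_coefS_1 /=.
  rewrite !mulr0 raddf0 !add0r.
  by rewrite mulr0 add0r mulrC.
apply: eq_bigr => i _.
rewrite raddfMn -mulrnDl mulrnAr; congr (_ *+ _).
rewrite /= DM !der_pow_coefS_1 der_pow_coefS iterS /E; ring.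
Qed.

(** Modulo p the convolution reduces to its terms i = 0 and i = p, which contain
    the vanishing factors a_(0,1) and a_(0,k-1). *)
Lemma der_pow_coef_pmult p k : prime p -> (1 < k < p)%N -> pmult p (a p k).
Proof.
move=> p_pr /andP[k_gt1 lt_kp]; have k_gt0 := ltnW k_gt1.
apply: (@pmult_coprime _ _ _ k) => //.
  by rewrite coprime_sym prime_coprime // gtnNdvd.
rewrite der_pow_coef_mulrn.
have := bconv_prime (fun i => shift_coef (a i) k) (fun i => a i 1) p_pr.
case: k k_gt1 {k_gt0 lt_kp} => [|[|k]] // _.
by rewrite /= !der_pow_coef0 mulr0 mul0r addr0 subr0.
Qed.

Lemma hochschild p x : prime p ->
  pmult p (iter p E x - (f ^+ p * iter p D x + iter p.-1 E f * D x)).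
Proof.
move=> p_pr; rewrite iter_fD_expand.
case: p p_pr (prime_gt1 p_pr) => [|[|n]] // p_pr _.
rewrite big_ord_recl big_ord_recl big_ord_recr /= der_pow_coefS_0 mul0r add0r.
rewrite /bump /= !add1n der_pow_coefS_1 der_pow_coef_diag.
set S := \sum_(i < n) _.
suff: pmult n.+2 S by congr pmult; rewrite /=; ring.
apply: pmult_sum => i _; rewrite mulrC; apply: pmultMl.
by apply: der_pow_coef_pmult => //=; rewrite !ltnS.
Qed.

Lemma iter_derMl n : f * iter n (fun x => D (f * x)) 1 = iter n E f.
Proof.
elim: n => [|n IHn]; first by rewrite mulr1.
by rewrite !iterS -IHn.
Qed.

(** Hochschild's formula at x = f, combined with the value of D^p on
    f^(p-1). The factor f ^+ 2 arises because E^p f = f * D (f * g) contains g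
    itself; that term cancels only against E^(p-1)(f) * D f = f * g * D f. *)
Theorem der_sum_pmult p : prime p ->
  pmult p (f ^+ 2 * D (iter p.-1 (fun x => D (f * x)) 1
                        + iter p.-1 D (f ^+ p.-1))).
Proof.
move=> p_pr.
have [n def_p] : exists n, p = n.+2.
  by case: p p_pr (prime_gt1 p_pr) => [|[|n]] // _ _; exists n.
set g := iter _ _ 1.
have Ef := hochschild f p_pr.
have Dpf := iter_der_expr n f p_pr.
have gE : iter p E f = f * D (f * g).
  by rewrite /g iter_derMl def_p.
rewrite gE -iter_derMl -/g DM in Ef.
(* The two congruences add up to p copies of f ^+ p * D^p f. *)
have := pmultD (pmultD Ef (pmultMl (f ^+ 2) Dpf))
  (ex_intro _ (f ^+ p * iter p D f) erefl).
have -> : D (g + iter p.-1 D (f ^+ p.-1)) = D g + iter p D (f ^+ n.+1).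
  by rewrite def_p raddfD.
congr pmult; rewrite [in RHS]mulrDr.
set Df := D f; set Dg := D g; set Dp := iter p D f; set X := iter p D _.
by rewrite def_p !exprS; ring.
Qed.

End Derivation.

(** * Coefficients of differential polynomials *)

Implicit Types P Q : dpoly.
Implicit Types m : {cmonom nat}.

Lemma mcoeff_monU_mulE m P k : (<< m >> * P)@_k =
  \sum_(n <- msupp P) P@_n *+ (mmul m n == k).
Proof.
rewrite (mcoeffMlw k msuppU_le (fsubset_refl _)) big_seq_fset1.
by apply: eq_bigr => n _; rewrite mcoeffUU mul1r.
Qed.

Lemma mcoeff_monU_mul m n P : (<< m >> * P)@_(mmul m n) = P@_n.
Proof.
rewrite mcoeff_monU_mulE [in RHS](monalgE P) raddf_sum.
apply: eq_bigr => k _; rewrite /= mcoeffU; congr (_ *+ nat_of_bool _).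
apply/eqP/eqP => [E|->//]; apply/eqP/cmP => i.
by have := congr1 (fun a : {cmonom nat} => a i) E; rewrite !cmM => /addnI.
Qed.

Lemma mcoeff_dder_mon m m' : (dder_mon m)@_m' =
  \sum_(k <- finsupp m)
    (mmul (divcm m (ucm k)) (ucm k.+1) == m')%:R *+ m k.
Proof.
rewrite /dder_mon raddf_sum; apply: eq_bigr => k _.
rewrite raddfMn; congr (_ *+ _).
apply: etrans (congr1 (mcoeff _) (malgU1_mul _ _)) _.
exact: mcoeffU1.
Qed.

Lemma mcoeff_dder P m' :
  (dder P)@_m' = \sum_(m <- msupp P) P@_m * (dder_mon m)@_m'.
Proof.
rewrite /dder mmapE raddf_sum; apply: eq_bigr => m _.
exact: mcoeffCM.
Qed.

(** * Homogeneity and the kernel of D modulo p *)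

Definition homog (n : nat) P := forall m, P@_m != 0 -> mdeg m = n.

Lemma homogD n P Q : homog n P -> homog n Q -> homog n (P + Q).
Proof.
move=> hP hQ m; rewrite mcoeffD; have [P0|/hP //] := eqVneq P@_m 0.
by rewrite P0 add0r; exact: hQ.
Qed.

Lemma homog1 : homog 0 1.
Proof.
by move=> m; rewrite mcoeff1; case: (m =P mone) => [->|//]; rewrite mdeg1.
Qed.

Lemma homog_dvar_mul n P : homog n P -> homog n.+1 (dvar 0 * P).
Proof.
move=> hP m; rewrite mcoeff_monU_mulE; apply: contraNeq => /eqP deg_m.
apply/eqP.
rewrite big_seq big1 // => k; rewrite -mcoeff_neq0 => /hP deg_k.
case: eqP => [def_m|_]; last by rewrite mulr0n.
by case: deg_m; rewrite -def_m mdegM mdegU deg_k.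
Qed.

Lemma homog_dder n P : homog n P -> homog n (dder P).
Proof.
move=> hP m'; apply: contraNeq => /eqP deg_m'; apply/eqP.
rewrite mcoeff_dder big_seq big1 // => m; rewrite -mcoeff_neq0 => /hP deg_m.
rewrite mcoeff_dder_mon big_seq big1 ?mulr0 // => k; rewrite -cmE_neq0 => mk.
case: eqP => [def_m'|_]; last by rewrite mul0rn.
case: deg_m'; rewrite -def_m' mdegM mdegU -deg_m -(mdegU k) -mdegM.
congr mdeg; apply/eqP/cmP => i; rewrite cmM divcmE cmU.
by case: eqP => [<-|_]; rewrite ?subn0 ?addn0 // subnK // lt0n.
Qed.

(** Descending induction on k shows that p divides the coefficients of all
    monomials containing f^(k). Homogeneity bounds the exponents by n < p; this
    matters, as D (f^p) = 0 mod p. *)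
Lemma dder_ker (p n : nat) P : prime p -> (0 < n < p)%N -> homog n P ->
  (forall m, (p %| (dder P)@_m)%Z) -> forall m, (p %| P@_m)%Z.
Proof.
move=> p_pr /andP[n_gt0 lt_np] hP DP.
(* No f^(k) with k >= N occurs in P. *)
pose N := (\max_(m <- msupp P) \max_(k <- finsupp m) k).+1%N.
suff dvd_k d k m : (N <= k + d)%N -> m k != 0%N -> (p %| P@_m)%Z.
  move=> m; have [->//|/hP deg_m] := eqVneq P@_m 0.
  have [m1|/fset0Pn [k km]] := eqVneq (finsupp m) fset0.
    by move: n_gt0; rewrite -deg_m mdegE m1 big_seq_fset0.
  by apply: (dvd_k N k); [rewrite leq_addl | rewrite cmE_neq0].
elim: d k m => [|d IHd] k m.
  rewrite addn0 => le_Nk mk; rewrite mcoeff_outdom // ?dvdz0 //.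
  apply: contraL le_Nk => mP; rewrite -ltnNge ltnS.
  apply: (@leq_trans (\max_(k <- finsupp m) k)).
    by apply: leq_bigmax_seq => //; rewrite -cmE_neq0.
  exact: (@leq_bigmax_seq _ _ xpredT
    (fun m : {cmonom nat} => \max_(k <- finsupp m) k)).
move=> le_N mk; pose m' := mmul (divcm m (ucm k)) (ucm k.+1).
have [->//|Pm] := eqVneq P@_m 0.
apply: contraT => ndvd.
have above (a : {cmonom nat}) j : (k < j)%N -> a j != 0%N -> (p %| P@_a)%Z.
  move=> lt_kj; apply: IHd; apply: leq_trans le_N _.
  by rewrite addnS -addSn leq_add2r.
(* m cannot contain f^(j) with j > k, else IHd would apply to it. *)
have m_above j : (k < j)%N -> m j = 0%N.
  by move=> lt_kj; apply/eqP; apply: contraNT ndvd => /above; apply.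
have m'k1 : m' k.+1 = 1%N.
  by rewrite cmM divcmE cmUU m_above.
have mP : m \in msupp P by rewrite -mcoeff_neq0.
have Dm : (dder_mon m)@_m' = (m k)%:Z.
  rewrite mcoeff_dder_mon (big_fsetD1 k) /= -?cmE_neq0 //= eqxx.
  rewrite big_seq big1 ?addr0; first exact: natz.
  move=> j; rewrite !inE => /andP[nkj jm].
  case: eqP => [E|_]; last by rewrite mul0rn.
  have := m'k1; rewrite -E cmM divcmE m_above // sub0n add0n cmU eqSS.
  by rewrite (negPf nkj).
have: (p %| P@_m * (m k)%:Z +
            \sum_(a <- (msupp P `\ m)%fset) P@_a * (dder_mon a)@_m')%Z.
  by rewrite -Dm; have := DP m'; rewrite mcoeff_dder (big_fsetD1 m mP).
(* Modulo p, the monomial m' of dder P can only come from m. *)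
rewrite rpredDr; last first.
  rewrite big_seq; apply: rpred_sum => a /fsetD1P[nam aP].
  rewrite mcoeff_dder_mon mulr_sumr big_seq; apply: rpred_sum => j.
  rewrite -cmE_neq0 => aj.
  case: eqP => [E|_]; last by rewrite mul0rn mulr0 rpred0.
  have [lt_kj|] := ltnP k j; first by apply: dvdz_mulr; exact: above aj.
  (* If j = k then a = m; if j < k then a contains f^(k.+1), as m' does. *)
  rewrite leq_eqVlt => /predU1P[def_j|lt_jk]; first subst j.
    case/eqP: nam; apply/eqP/cmP => i.
    have := congr1 (fun b : {cmonom nat} => b i) E.
    rewrite !cmM !divcmE !cmU => /addIn; case: (k =P i) => [<- E1|_].
      by rewrite -(@subnK 1 (a k)) ?lt0n // E1 subnK ?lt0n.
    by rewrite !subn0.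
  apply: dvdz_mulr; apply: (@above _ k.+1) => //.
  have := m'k1; rewrite -E cmM divcmE !cmU eqSS.
  by rewrite (ltn_eqF lt_jk) addn0 (ltn_eqF (leqW lt_jk)) subn0 => ->.
rewrite dvdzE abszM Euclid_dvdM // => /orP[dvd_P|].
  by case/negP: ndvd; rewrite dvdzE.
move=> /dvdn_leq; rewrite lt0n => /(_ mk) le_p_mk.
suff: (p <= mdeg m)%N by rewrite (hP _ Pm) leqNgt lt_np.
apply: leq_trans le_p_mk _; rewrite mdegE.
have km : k \in finsupp m by rewrite -cmE_neq0.
by rewrite (big_fsetD1 k km) leq_addr.
Qed.

Theorem theorem2 (p : nat) (hp : prime p) :
  dpoly_congr p
    (weval (wexp [:: Ld; Lf] p.-1))
    (- weval (wexp [:: Ld] p.-1 ++ wexp [:: Lf] p.-1)).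
Proof.
rewrite weval_df weval_dX_fX => m.
rewrite mcoeffB mcoeffN opprK -mcoeffD; move: m.
have p_gt1 := prime_gt1 hp.
apply: (@dder_ker p p.-1) => //.
- by rewrite -ltnS prednK ?p_gt1 ?leqnn // ltnW.
- apply: homogD.
    elim: p.-1 => [|n IHn]; first exact: homog1.
    by rewrite iterS; apply/homog_dder/homog_dvar_mul.
  elim: {2}p.-1 => [|n IHn]; last by rewrite iterS; apply: homog_dder.
  elim: p.-1 => [|n IHn]; first exact: homog1.
  by rewrite exprS; apply: homog_dvar_mul.
move=> m.
have [Y] := der_sum_pmult (D := dder) dderM (dvar 0) hp.
move/(congr1 (mcoeff (mmul (ucm 0) (mmul (ucm 0) m)))).
rewrite expr2 -mulrA !mcoeff_monU_mul mcoeffMn -mulr_natr natz => ->.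
by rewrite dvdz_mull.
Qed.
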